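(* Let $(X,\mu)$ be a standard probability space with a measure-preserving countable Borel equivalence relation $R$. Suppose $\mu$ has a disintegration of the form $\mu=\int_X p_x\,d\nu(x)$, where for $\nu$-a.e. $x$ the measure $p_x$ is an $R$-invariant probability measure for which $(X,p_x,R)$ is sofic. Then $(X,\mu,R)$ is also sofic. In particular, if almost every ergodic component of $R$ is sofic, then so is $(X,\mu,R)$.
   Context: A standard probability space $(X,\mu)$ is a standard Borel space with a Borel probability measure. A countable Borel equivalence relation $R$ on $X$ is an equivalence relation that is Borel in $X\times X$ with all classes countable. $[[R]]_B$ is the set of Borel isomorphisms $g:\operatorname{dom}g\to\operatorname{ran}g$ between Borel subsets of $X$ with $(x,gx)\in R$ for all $x\in\operatorname{dom}g$; it is an inverse monoid under composition of partial maps. A Borel probability measure $\mu$ is $R$-invariant ($R$ is measure-preserving) if $\mu(g(A))=\mu(A)$ for all $g\in[[R]]_B$ and Borel $A\subseteq\operatorname{dom}g$. The full semigroup $[[R]]=[[R]]_\mu$ is the quotient of $[[R]]_B$ by the pseudometric $d_\mu(g,h)=\mu(\operatorname{dom}g\triangle\operatorname{dom}h)+\mu\{x\in\operatorname{dom}g\cap\operatorname{dom}h:gx\ne hx\}$. For $N\in\mathbb{N}$, $[N]=\{0,\dots,N-1\}$ carries normalized counting measure $\mu_\#$, $[[N]]$ is the set of all partial bijections of $[N]$, and $d_\#$ is the analogous metric on $[[N]]$ defined with $\mu_\#$. The system $(X,\mu,R)$ is sofic if for each finite $K\subseteq[[R]]_\mu$ and $\epsilon>0$ there exist $N\in\mathbb{N}$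 and $\pi:[[R]]_\mu\to[[N]]$ with: (i) $\pi(\operatorname{id}_X)=1_{[N]}$ and $\pi(\varnothing)=\varnothing$; (ii) $d_\#(\pi(\varphi\psi),\pi(\varphi)\pi(\psi))<\epsilon$ for all $\varphi,\psi\in K$; (iii) $|\mu\{x:\varphi(x)=x\}-\mu_\#\{m:\pi(\varphi)(m)=m\}|<\epsilon$ for all $\varphi\in K$. The disintegration $\mu=\int_Xp_x\,d\nu(x)$ means: $\nu$ is a Borel probability measure on $X$, and for each Borel $A\subseteq X$ the function $x\mapsto p_x(A)$ is measurable and $\mu(A)=\int_Xp_x(A)\,d\nu(x)$. The ergodic components of $R$ are the systems $(X,p_x,R)$ arising from the ergodic decomposition of $\mu$ into $R$-invariant ergodic probability measures $p_x$. *)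

(* Defs.v *)
From HB Require Import structures.
From mathcomp Require Import all_boot all_order all_algebra.
From mathcomp Require Import all_classical all_reals all_analysis.

Set Implicit Arguments.
Unset Strict Implicit.
Unset Printing Implicit Defensive.

Import Order.TTheory GRing.Theory Num.Theory.

Local Open Scope classical_set_scope.
Local Open Scope ring_scope.

#[local] Obligation Tactic := idtac.

(* The sigma-algebra of [T] is the Borel sigma-algebra of a Polish space,
   transported along a bijection. *)
Definition standard_borel (R : realType) (d : measure_display)
    (T : measurableType d) : Prop :=
  exists M : metricType R,
    [/\ (forall F : set_system M, ProperFilter F -> cauchy F ->
           exists x : M, F --> x),
        (exists2 D : set M, countable D & dense D) &
        exists2 f : T -> M, bijective f &
          forall B : set M, <<s open >> B <-> measurable (f @^-1` B)].

(** ** Partial maps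

   A partial map is a function to an option type, [None] meaning that the map
   is undefined at the argument. *)

Definition pdom (T U : Type) (f : T -> option U) : set T := [set x | f x].

Definition pimage (T U : Type) (f : T -> option U) (A : set T) : set U :=
  [set y | exists2 x, A x & f x = Some y].

Definition ppreimage (T U : Type) (f : T -> option U) (B : set U) : set T :=
  [set x | exists2 y, B y & f x = Some y].

Definition pinjective (T U : Type) (f : T -> option U) : Prop :=
  forall x y z, f x = Some z -> f y = Some z -> x = y.

(* [pcomp f g] is [f] after [g]. *)
Definition pcomp (T U V : Type) (f : U -> option V) (g : T -> option U)
  : T -> option V := fun x => obind f (g x).

Lemma pcomp_inj (T U V : Type) (f : U -> option V) (g : T -> option U) :
  pinjective f -> pinjective g -> pinjective (pcomp f g).
Proof.
move=> fi gi x y z; rewrite /pcomp.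
case gx: (g x) => [a|//] /= fa; case gy: (g y) => [b|//] /= fb.
by apply: gi gx _; rewrite (fi _ _ _ fa fb).
Qed.

Lemma ppreimage_comp (T U V : Type) (f : U -> option V) (g : T -> option U) B :
  ppreimage (pcomp f g) B = ppreimage g (ppreimage f B).
Proof.
apply/seteqP; split=> x /=; rewrite /ppreimage /pcomp /=.
- by case gx: (g x) => [a|] [y By] //= fa; exists a => //; exists y.
- by case=> a [y By fa] ->; exists y.
Qed.

Lemma pimage_comp (T U V : Type) (f : U -> option V) (g : T -> option U) A :
  pimage (pcomp f g) A = pimage f (pimage g A).
Proof.
apply/seteqP; split=> z /=; rewrite /pimage /pcomp /=.
- case=> x Ax; case gx: (g x) => [a|] //= fa.
  by exists a => //; exists x.
- by case=> a [x Ax gx] fa; exists x => //; rewrite gx.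
Qed.

Lemma pimage_id (T : Type) (A : set T) : pimage Some A = A.
Proof.
by apply/seteqP; split=> x /= => [[y Ay [<-]]//|Ax]; exists x.
Qed.

Lemma ppreimage_id (T : Type) (A : set T) : ppreimage Some A = A.
Proof.
by apply/seteqP; split=> x /= => [[y Ay [->]]//|Ax]; exists x.
Qed.

Lemma pimage_empty (T U : Type) (A : set T) :
  pimage (fun=> @None U) A = set0.
Proof. by apply/seteqP; split=> x //= []. Qed.

Lemma ppreimage_empty (T U : Type) (B : set U) :
  ppreimage (fun _ : T => @None U) B = set0.
Proof. by apply/seteqP; split=> x //= []. Qed.

(** ** Countable Borel equivalence relations and their partial isomorphisms *)

Record cber (d : measure_display) (T : measurableType d) := CBER {
  cber_rel : set (T * T) ;
  cber_measurable : measurable cber_rel ;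
  cber_refl : forall x, cber_rel (x, x) ;
  cber_sym : forall x y, cber_rel (x, y) -> cber_rel (y, x) ;
  cber_trans : forall x y z,
    cber_rel (x, y) -> cber_rel (y, z) -> cber_rel (x, z) ;
  cber_countable : forall x, countable [set y | cber_rel (x, y)] }.

(* The inverse monoid [[E]]_B. The last two fields say that the domain and the
   range are Borel (take the full set for [B] and [A]) and that the bijection
   between them is Borel in both directions. *)
Record pisom (d : measure_display) (T : measurableType d) (E : cber T) :=
  PIsom {
    pisom_fun :> T -> option T ;
    pisom_inj : pinjective pisom_fun ;
    pisom_rel : forall x y, pisom_fun x = Some y -> cber_rel E (x, y) ;
    pisom_preimage : forall B, measurable B -> measurable (ppreimage pisom_fun B) ;
    pisom_image : forall A, measurable A -> measurable (pimage pisom_fun A) }.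

Section pisom_monoid.
Context (d : measure_display) (T : measurableType d) (E : cber T).

Program Definition pisom_id : pisom E := @PIsom _ _ _ Some _ _ _ _.
Next Obligation. by move=> x y z [->] [->]. Qed.
Next Obligation. by move=> /= x y [<-]; exact: cber_refl. Qed.
Next Obligation. by move=> /= B mB; rewrite ppreimage_id. Qed.
Next Obligation. by move=> /= A mA; rewrite pimage_id. Qed.

Program Definition pisom_empty : pisom E := @PIsom _ _ _ (fun=> None) _ _ _ _.
Next Obligation. by []. Qed.
Next Obligation. by []. Qed.
Next Obligation. by move=> /= B mB; rewrite ppreimage_empty. Qed.
Next Obligation. by move=> /= A mA; rewrite pimage_empty. Qed.

Program Definition pisom_mul (g h : pisom E) : pisom E :=
  @PIsom _ _ _ (pcomp g h) _ _ _ _.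
Next Obligation. by move=> g h; apply: pcomp_inj; exact: pisom_inj. Qed.
Next Obligation.
move=> g h x y; rewrite /pcomp; case hx: (h x) => [a|] //= ga.
exact: cber_trans (pisom_rel hx) (pisom_rel ga).
Qed.
Next Obligation.
move=> g h B mB; rewrite ppreimage_comp.
by apply: pisom_preimage; exact: pisom_preimage.
Qed.
Next Obligation.
move=> g h A mA; rewrite pimage_comp.
by apply: pisom_image; exact: pisom_image.
Qed.

End pisom_monoid.

Definition invariant_measure (R : realType) (d : measure_display)
    (T : measurableType d) (E : cber T) (mu : {measure set T -> \bar R}) : Prop :=
  forall (g : pisom E) (A : set T), measurable A -> A `<=` pdom g ->
    mu (pimage g A) = mu A.

Definition ergodic_measure (R : realType) (d : measure_display)
    (T : measurableType d) (E : cber T) (mu : {measure set T -> \bar R}) : Prop :=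
  forall A : set T, measurable A -> (forall x y, cber_rel E (x, y) -> A x -> A y) ->
    mu A = 0%E \/ mu (~` A) = 0%E.

(** ** The full semigroup [[E]]_mu *)

Definition pisom_dist (R : realType) (d : measure_display)
    (T : measurableType d) (E : cber T) (mu : {measure set T -> \bar R})
    (g h : pisom E) : \bar R :=
  (mu (pdom g `+` pdom h)
   + mu [set x | [/\ pdom g x, pdom h x & g x <> h x]])%E.

(* The quotient of [[E]]_B by the pseudometric, as a type of classes. *)
Definition full_semigroup (R : realType) (d : measure_display)
    (T : measurableType d) (E : cber T) (mu : {measure set T -> \bar R}) :=
  {C : set (pisom E) | exists g, C = [set h | pisom_dist mu g h = 0%E]}.

Definition pclass (R : realType) (d : measure_display)
    (T : measurableType d) (E : cber T) (mu : {measure set T -> \bar R})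
    (g : pisom E) : full_semigroup E mu :=
  exist _ [set h | pisom_dist mu g h = 0%E] (ex_intro _ g erefl).

(** ** The partial bijections [[N]] of {0, ..., N-1} *)

Record pbij (N : nat) := PBij {
  pbij_fun :> 'I_N -> option 'I_N ;
  pbij_inj : pinjective pbij_fun }.

Program Definition pbij_id (N : nat) : pbij N := @PBij N Some _.
Next Obligation. by move=> N x y z [->] [->]. Qed.

Program Definition pbij_empty (N : nat) : pbij N := @PBij N (fun=> None) _.
Next Obligation. by []. Qed.

Definition pbij_mul (N : nat) (f g : pbij N) : pbij N :=
  PBij (pcomp_inj (@pbij_inj N f) (@pbij_inj N g)).

Definition mu_count (R : realType) (N : nat) (A : pred 'I_N) : R :=
  #|A|%:R / N%:R.

Definition pbij_dist (R : realType) (N : nat) (f g : pbij N) : R :=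
  mu_count R [pred m | isSome (f m) != isSome (g m)]
  + mu_count R [pred m | [&& isSome (f m), isSome (g m) & f m != g m]].

(** ** Soficity *)

(* The conditions on [K] range over representatives: when [mu] is an
   [E]-invariant measure on a standard Borel space, the class of a product and
   the measure of a fixed point set depend only on the classes of the maps. *)
Definition sofic (R : realType) (d : measure_display) (T : measurableType d)
    (E : cber T) (mu : {measure set T -> \bar R}) : Prop :=
  forall (K : set (full_semigroup E mu)) (eps : R), finite_set K -> 0 < eps ->
  exists (N : nat) (pi : full_semigroup E mu -> pbij N),
    [/\ (0 < N)%N,
        pi (pclass mu (pisom_id E)) = pbij_id N,
        pi (pclass mu (pisom_empty E)) = pbij_empty N,
        (forall g h : pisom E, K (pclass mu g) -> K (pclass mu h) ->
          pbij_dist R (pi (pclass mu (pisom_mul g h)))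
            (pbij_mul (pi (pclass mu g)) (pi (pclass mu h))) < eps) &
        (forall g : pisom E, K (pclass mu g) ->
          `| fine (mu [set x | g x = Some x])
             - mu_count R [pred m | pi (pclass mu g) m == Some m] | < eps)].

(** ** Disintegrations *)

(* Measurability of [x |-> p x A] for Borel [A] is part of the kernel
   structure; [p x] need not be a probability measure for every [x]. *)
Definition disintegration (R : realType) (d : measure_display)
    (T : measurableType d) (mu nu : probability T R) (p : R.-ker T ~> T) : Prop :=
  forall A : set T, measurable A -> mu A = (\int[nu]_x p x A)%E.

Definition ergodic_decomposition (R : realType) (d : measure_display)
    (T : measurableType d) (E : cber T) (mu nu : probability T R)
    (p : R.-ker T ~> T) : Prop :=
  disintegration mu nu p /\
  {ae nu, forall x, [/\ p x [set: T] = 1%E, invariant_measure E (p x)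
                      & ergodic_measure E (p x)]}.

(* Main.v *)
Require Import Defs.
From HB Require Import structures.
From mathcomp Require Import all_boot all_order all_algebra.
From mathcomp Require Import all_classical all_reals all_analysis.
From mathcomp Require Import measurable_realfun lra ring.

Set Implicit Arguments.
Unset Strict Implicit.
Unset Printing Implicit Defensive.

Import Order.TTheory GRing.Theory Num.Theory.

Local Open Scope classical_set_scope.
Local Open Scope ring_scope.

(** Soficity only sees finitely many elements of the full semigroup at a time,
    and about a single element [g] only the number [mu (Fix g)].  Both demands
    on a sofic approximation are stable under averaging: if [s_j] is a family of
    approximations by partial bijections of [N_j] points, then blowing each one
    up to a common number of points and taking the disjoint union yields one
    approximation whose multiplicativity defect is the average of the defects
    and whose proportion of fixed points is the average of the proportions
    ([amalgam_mul], [pbij_dist_amalgam], [mu_count_fix_amalgam]).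

    The numbers [mu (Fix g)] are in turn averages: [mu (Fix g)] is the integral
    of [x |-> p x (Fix g)].  For finitely many [g] at once, the integrals of
    these bounded functions are approximated by their arithmetic mean over
    finitely many sample points [y_j], possibly repeated, taken in any
    prescribed conull set ([empirical_average]): cut the cube of values into
    small cells, take one sample point over each cell, and replace the measures
    of the cells by rational weights.  Amalgamating the sofic approximations
    of the systems [p (y_j)] then gives a sofic approximation of [mu].  No
    measurable selection is involved, as only finitely many points are used.

    It remains to compare the quotients of [[E]]_B by the different measures.
    A representative is chosen for every class modulo [mu]; an equality of
    classes modulo [mu] persists modulo [p x] for almost every [x]
    ([disintegration_null]), so the finitely many identities between
    representatives that the argument needs hold on a conull set of [x].
    The invariance of [mu] makes the product of classes well defined
    ([pclass_mul]), and the standard Borel structure provides a countable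
    separating family of Borel sets, which makes the set where two partial
    isomorphisms differ, and the fixed point sets, Borel
    ([measurable_pdiff], [measurable_pfix]). *)

(** * Integrals as averages over finitely many points *)

(** Rounding the multiples [M * w q] up to integers changes each of them by at
    most 1, hence all weighted sums by an amount that does not grow with [M]. *)
Lemma integer_weights (R : realType) (C : finType) (w : C -> R) (eps : R) :
  (forall q, 0 <= w q) -> \sum_q w q = 1 -> 0 < eps ->
  exists2 n : C -> nat, (0 < \sum_q n q)%N &
    forall t : C -> R, (forall q, 0 <= t q <= 1) ->
      `| (\sum_q n q)%:R^-1 * (\sum_q (n q)%:R * t q) - \sum_q w q * t q |
         < eps.
Proof.
move=> w0 w1 e0.
(* The numerator and the normalization are each off by at most #|C|. *)
pose M : nat := (Num.truncn (#|C|%:R *+ 2 / eps)).+1.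
have MC : #|C|%:R *+ 2 < eps * M%:R.
  by rewrite -ltr_pdivrMl // mulrC truncnS_gt.
have C0 : (0 < #|C|)%N.
  rewrite lt0n; apply/eqP => /card0_eq C0; move: w1; rewrite big_pred0 //.
  by move/eqP; rewrite eq_sym oner_eq0.
pose n q := (Num.truncn (M%:R * w q)).+1.
have nw q : 0 <= (n q)%:R - M%:R * w q <= 1.
  have /andP[h1 h2] := truncn_itv (mulr_ge0 (ler0n R M) (w0 q)).
  by move: h1 h2; rewrite /n -natr1; lra.
pose m := (\sum_q n q)%N.
have mM : 0 <= (m%:R : R) - M%:R <= #|C|%:R.
  have -> : m%:R - M%:R = \sum_q ((n q)%:R - M%:R * w q).
    by rewrite sumrB -mulr_sumr w1 mulr1 /m natr_sum.
  rewrite sumr_ge0 /=; last by move=> q _; case/andP: (nw q).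
  rewrite -[leRHS]mulr1 -[#|C|]sum1_card natr_sum mulr_suml.
  by apply: ler_sum => q _; rewrite mul1r; case/andP: (nw q).
have M0 : 0 < M%:R :> R by rewrite ltr0n.
have m0 : 0 < m%:R :> R by move: mM; lra.
exists n; first by rewrite -(ltr0n R).
move=> t t01; rewrite -/m.
set S := \sum_q w q * t q.
have S01 : 0 <= S <= 1.
  rewrite sumr_ge0 /=; last first.
    by move=> q _; apply: mulr_ge0 => //; case/andP: (t01 q).
  rewrite -w1; apply: ler_sum => q _.
  by rewrite -[leRHS]mulr1; apply: ler_wpM2l => //; case/andP: (t01 q).
set A := \sum_q _.
have AS : 0 <= A - M%:R * S <= #|C|%:R.
  have -> : A - M%:R * S = \sum_q ((n q)%:R - M%:R * w q) * t q.
    rewrite mulr_sumr -sumrB; apply: eq_bigr => q _; ring.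
  rewrite sumr_ge0 /=; last first.
    by move=> q _; apply: mulr_ge0; [case/andP: (nw q)|case/andP: (t01 q)].
  rewrite -[#|C|]sum1_card natr_sum; apply: ler_sum => q _.
  by apply: mulr_ile1; [case/andP: (nw q)|case/andP: (t01 q)
    |case/andP: (nw q)|case/andP: (t01 q)].
have -> : m%:R^-1 * A - S = (A - m%:R * S) / m%:R.
  by field; rewrite gt_eqF.
rewrite normrM normfV (gtr0_norm m0) ltr_pdivrMr //.
have mS : 0 <= (m%:R - M%:R) * S <= #|C|%:R.
  case/andP: mM => mM1 mM2; case/andP: S01 => S0 S1.
  rewrite mulr_ge0 //= -[leRHS]mulr1; exact: ler_pM.
have : eps * M%:R <= eps * m%:R.
  by apply: ler_wpM2l; [exact: ltW|move: mM; lra].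
have -> : A - m%:R * S = (A - M%:R * S) - (m%:R - M%:R) * S by ring.
move: AS mS MC; set a := _ - M%:R * S; set b := _ * S => ? ? ? ?.
have ? : 0 < #|C|%:R :> R by rewrite ltr0n.
by rewrite ltr_norml; lra.
Qed.

Lemma integral_finite_valued (R : realType) (d : measure_display)
    (X : measurableType d) (nu : probability X R) (C : finType) (c : X -> C)
    (t : C -> R) :
  (forall q, measurable (c @^-1` [set q])) -> (forall q, 0 <= t q) ->
  measurable_fun setT (t \o c) /\
  (\int[nu]_x (t (c x))%:E = (\sum_q fine (nu (c @^-1` [set q])) * t q)%:E)%E.
Proof.
move=> mc t0.
have tE x : ((t (c x))%:E = \sum_q ((t q)%:E * (\1_(c @^-1` [set q]) x)%:E))%E.
  rewrite (bigD1 (c x)) //= big1 ?adde0.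
    by rewrite indicE mem_set // mule1.
  move=> q qcx; rewrite indicE memNset ?mule0 // => /= /eqP.
  by rewrite eq_sym (negbTE qcx).
have mi q : measurable_fun setT
    ((fun x => (t q)%:E * (\1_(c @^-1` [set q]) x)%:E)%E : X -> \bar R).
  by apply: measurable_funeM; apply/measurable_EFinP; exact: measurable_indic.
split.
  apply/measurable_EFinP; rewrite (_ : _ \o _ =
    fun x => \sum_q ((t q)%:E * (\1_(c @^-1` [set q]) x)%:E)%E).
    exact: emeasurable_sum.
  by apply/funext => x; rewrite /= tE.
rewrite (eq_integral _ _ (fun x _ => tE x)) ge0_integral_sum //; last first.
  by move=> q x _; rewrite mule_ge0 ?lee_fin.
rewrite -sumEFin; apply: eq_bigr => q _.
rewrite ge0_integralZl_EFin //; last first.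
  by apply/measurable_EFinP; exact: measurable_indic.
rewrite integral_indic //.
rewrite setIT EFinM fineK; first exact: muleC.
by apply: fin_num_measure; exact: mc.
Qed.

(** A deterministic law of large numbers for finitely many functions.  The
    sample is a finite family rather than a weighted sum, so that it can index
    a disjoint union of finite models; points occur in it with multiplicity. *)
Lemma empirical_average (R : realType) (d : measure_display)
    (X : measurableType d) (nu : probability X R) (I : finType)
    (v : I -> X -> R) (a : I -> R) (G : X -> Prop) (eps : R) :
  (forall i, measurable_fun setT (v i)) ->
  (forall i x, 0 <= v i x <= 1) ->
  (forall i, \int[nu]_x (v i x)%:E = (a i)%:E)%E ->
  {ae nu, forall x, G x} -> 0 < eps ->
  exists (J : finType) (y : J -> X),
    [/\ (0 < #|J|)%N, (forall j, G (y j)) &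
        forall i, `| a i - #|J|%:R^-1 * \sum_j v i (y j) | < eps].
Proof.
move=> mv v01 va aeG e0.
have [x0 Gx0] : exists x, G x.
  have nuT : (0 < nu [set: X])%E by rewrite probability_setT lte01.
  exact: (@filter_ex _ _ (ae_properfilter_algebraOfSetsType nuT) _ aeG).
pose dl := eps / 3.
have dl0 : 0 < dl by rewrite divr_gt0.
pose k : nat := (Num.truncn dl^-1).+1.
have k0 : 0 < k%:R :> R by rewrite ltr0n.
have kdl : k%:R^-1 < dl.
  by rewrite invf_plt ?posrE //; exact: truncnS_gt.
(* Cells: the values of all [v i] are recorded up to precision [1 / k]. *)
pose cell x i := Num.truncn (k%:R * v i x).
have cellk x i : (cell x i < k.+1)%N.
  rewrite ltnS; rewrite truncn_le_nat -natr1.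
  have : k%:R * v i x <= k%:R.
    by rewrite -[leRHS]mulr1; apply: ler_wpM2l => //; case/andP: (v01 i x).
  lra.
pose C : finType := {ffun I -> 'I_k.+1}.
pose c (x : X) : C := [ffun i => Ordinal (cellk x i)].
have cell_close x y i : c x = c y -> `|v i x - v i y| <= dl.
  move/ffunP/(_ i); rewrite !ffunE => /(congr1 val) /= cxy.
  apply: le_trans (ltW kdl).
  have /andP[h1 h2] := truncn_itv (mulr_ge0 (ltW k0) (andP (v01 i x)).1).
  have /andP[h3 h4] := truncn_itv (mulr_ge0 (ltW k0) (andP (v01 i y)).1).
  rewrite -(ler_pM2l k0) mulfV ?gt_eqF // -[in leLHS](gtr0_norm k0) -normrM.
  move: h1 h2 h3 h4; rewrite -/(cell x i) cxy -/(cell y i) -natr1 mulrBr.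
  by rewrite ler_norml; lra.
have mc q : measurable (c @^-1` [set q]).
  rewrite (_ : _ @^-1` _ = \bigcap_(i in [set: I])
      (v i @^-1` `[(q i)%:R / k%:R, (q i).+1%:R / k%:R[)); last first.
    have cE x i : (val (q i) == cell x i)
        = (v i x \in `[(q i)%:R / k%:R, (q i).+1%:R / k%:R[).
      rewrite eq_sym truncn_eq; last first.
        by apply: mulr_ge0; [exact: ltW|case/andP: (v01 i x)].
      by rewrite in_itv /= ler_pdivrMr // ltr_pdivlMr // mulrC.
    apply/seteqP; split=> x /=.
      by move=> qx i _; have := cE x i; rewrite -{1}qx ffunE eqxx => /esym.
    move=> qx; apply/ffunP => i; apply/val_inj; rewrite ffunE /=.
    by apply/esym/eqP; rewrite (cE x i); exact: qx.
  apply: fin_bigcap_measurable => // i _; rewrite -[X in measurable X]setTI.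
  by apply: mv.
pose w q := fine (nu (c @^-1` [set q])).
have w0 q : 0 <= w q by apply: fine_ge0.
have w1 : \sum_q w q = 1.
  have [_] := @integral_finite_valued R d X nu C c (fun=> 1) mc (fun=> ler01).
  rewrite integral_cst //= probability_setT mule1 => /esym [] <-.
  by apply: eq_bigr => q _; rewrite mulr1.
(* A cell that misses [G] is null, so any point of [G] can represent it. *)
pose rep q : X := xget x0 [set x | G x /\ c x = q].
have repG q : G (rep q).
  by rewrite /rep; case: xgetP => [x -> []|].
have rep_close x i : G x -> `|v i x - v i (rep (c x))| <= dl.
  move=> Gx; apply: cell_close; rewrite /rep.
  by case: xgetP => [y _ [_ ->] //|/(_ x) []].
have int_close i : `|a i - \sum_q w q * v i (rep q)| <= dl.
  have vr0 q : 0 <= v i (rep q) by case/andP: (v01 i (rep q)).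
  have [m1 i1] := integral_finite_valued nu mc vr0.
  (* Adding [dl] to a nonnegative function, instead of subtracting it, keeps
     every integrand nonnegative. *)
  have shift (f : X -> R) (b : R) : measurable_fun setT f ->
      (forall x, 0 <= f x) -> (\int[nu]_x (f x)%:E = b%:E)%E ->
      (\int[nu]_x (f x + dl)%:E = (b + dl)%:E)%E.
    move=> mf f0 fb; under eq_integral do rewrite EFinD.
    rewrite ge0_integralD //.
    - by rewrite fb integral_cst //= probability_setT mule1.
    - by move=> x _; rewrite lee_fin.
    - exact/measurable_EFinP.
    - by move=> x _; rewrite lee_fin ltW.
  have mvE : measurable_fun setT (fun x => (v i x)%:E).
    exact/measurable_EFinP.
  have v0 x : 0 <= v i x by case/andP: (v01 i x).
  have mD (f : X -> R) : measurable_fun setT f ->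
      measurable_fun setT (fun x => (f x + dl)%:E).
    by move=> mf; apply/measurable_EFinP; exact: measurable_funD.
  have le1 : a i <= \sum_q w q * v i (rep q) + dl.
    rewrite -lee_fin -(shift _ _ m1 (fun x => vr0 (c x)) i1) -va.
    apply: ae_ge0_le_integral => //.
    - by move=> x _; rewrite lee_fin.
    - by move=> x _; rewrite lee_fin addr_ge0 ?(ltW dl0) //; exact: vr0.
    - exact: mD.
    - apply: filterS aeG => x /(rep_close _ i) + _; rewrite ler_distl lee_fin.
      by rewrite /=; lra.
  have le2 : \sum_q w q * v i (rep q) <= a i + dl.
    rewrite -lee_fin -i1 -(shift _ _ (mv i) v0 (va i)).
    apply: ae_ge0_le_integral => //.
    - by move=> x _; rewrite lee_fin.
    - exact/measurable_EFinP.
    - by move=> x _; rewrite lee_fin addr_ge0 // ltW.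
    - exact: mD.
    - apply: filterS aeG => x /(rep_close _ i) + _; rewrite ler_distl lee_fin.
      by lra.
  by rewrite ler_distl; move: le1 le2; lra.
have [n n0 nP] := integer_weights w0 w1 dl0.
have cJ : #|{: {q : C & 'I_(n q)}}| = (\sum_q n q)%N.
  rewrite -sum1_card (eq_bigr (fun=> 1%N)) //.
  rewrite -(sig_big_dep xpredT (fun q => xpredT) (fun q (j : 'I_(n q)) => 1%N)).
  by apply: eq_bigr => q _; rewrite sum_nat_const card_ord muln1.
exists {q : C & 'I_(n q)}, (fun j => rep (tag j)); split.
- by rewrite cJ.
- by move=> j; exact: repG.
move=> i; have := nP (fun q => v i (rep q)) (fun q => v01 i _).
have := int_close i; rewrite cJ.
rewrite -(sig_big_dep xpredT (fun q => xpredT)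
            (fun q (j : 'I_(n q)) => v i (rep q))).
have -> : \sum_q \sum_(j < n q) v i (rep q) = \sum_q (n q)%:R * v i (rep q).
  by apply: eq_bigr => q _; rewrite sumr_const card_ord mulr_natl.
rewrite ler_norml !ltr_norml /dl; lra.
Qed.

(** * Amalgamation of finite models *)

Lemma pbij_eq (N : nat) (f g : pbij N) : f =1 g -> f = g.
Proof.
case: f g => [f fi] [g gi] /= /funext fg.
by case: _ / fg gi => gi; congr PBij; exact: Prop_irrelevance.
Qed.

Lemma card_sigma_prod (J : finType) (N : J -> nat) (M : J -> nat)
    (P : forall j, pred 'I_(N j)) :
  #|[pred u : {j : J & ('I_(N j) * 'I_(M j))%type} | P (tag u) (tagged u).1]|
  = (\sum_j #|P j| * M j)%N.
Proof.
rewrite -sum1_card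
  -(sig_big_dep xpredT (fun j (ab : 'I_(N j) * 'I_(M j)) => P j ab.1)
      (fun j ab => 1%N)).
apply: eq_bigr => j _.
transitivity (\sum_(a | P j a) \sum_(b < M j) 1)%N.
  by rewrite pair_big /=; apply: eq_bigl => ab; rewrite andbT.
by rewrite !sum_nat_const card_ord muln1.
Qed.

Section amalgam.
Variables (J : finType) (N : J -> nat).
Hypothesis N_gt0 : forall j, (0 < N j)%N.

Let L : nat := (\prod_j N j)%N.

Let L_gt0 : (0 < L)%N. Proof. by rewrite prodn_gt0. Qed.

Let N_dvd j : (N j %| L)%N.
Proof. by rewrite /L (bigD1 j) //= dvdn_mulr. Qed.

(** The [j]-th summand consists of [L / N j] copies of the [N j] points, so that
    every summand has [L] points and weighs the same. *)
Definition amalgam_points : finType :=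
  {j : J & ('I_(N j) * 'I_(L %/ N j))%type}.

Definition amalgam_size : nat := #|amalgam_points|.

Let code (u : amalgam_points) : 'I_amalgam_size := enum_rank u.
Let decode (i : 'I_amalgam_size) : amalgam_points := enum_val i.

Let codeK : cancel code decode. Proof. exact: enum_rankK. Qed.
Let decodeK : cancel decode code. Proof. exact: enum_valK. Qed.
Let code_inj : injective code. Proof. exact: can_inj codeK. Qed.

Definition amalgam_fun (s : forall j, pbij (N j)) (i : 'I_amalgam_size)
    : option 'I_amalgam_size :=
  let u := decode i in
  omap (fun a => code (Tagged _ (a, (tagged u).2)))
    (s (tag u) (tagged u).1).

Lemma amalgam_inj s : pinjective (amalgam_fun s).
Proof.
move=> x y z; rewrite /amalgam_fun.
rewrite -[x]decodeK -[y]decodeK !codeK.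
case: (decode x) (decode y) => [j [a b]] [j' [a' b']] /=.
case sa: (s j a) => [c|] //=; case sb: (s j' a') => [c'|] //= [<-].
move=> [] /code_inj E; congr code.
move: E sa sb; set u := Tagged _ (c, b) => E.
have jj' : j' = j by move: (congr1 (fun v : amalgam_points => tag v) E).
case: _ / jj' a c b u E => a c b u /eqP.
rewrite /u eq_Tagged /= => /eqP [-> ->] sa sb.
by rewrite (pbij_inj sa sb).
Qed.

Definition amalgam s : pbij amalgam_size := PBij (@amalgam_inj s).

Lemma amalgam_id : amalgam (fun j => pbij_id (N j)) =1 pbij_id _.
Proof.
move=> i; rewrite /= /amalgam_fun /= -[RHS]/(Some i); congr Some.
by rewrite -[RHS]decodeK; congr code; case: (decode i) => j [].
Qed.

Lemma amalgam_mul s t :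
  amalgam (fun j => pbij_mul (s j) (t j)) =1 pbij_mul (amalgam s) (amalgam t).
Proof.
move=> i; rewrite /= /amalgam_fun /= /Defs.pcomp.
case: (decode i) => j [a b] /=.
case ta: (t j a) => [c|] //=; rewrite codeK /=.
by case: (s j c).
Qed.

Lemma amalgam_size_gt0 : (0 < #|J|)%N -> (0 < amalgam_size)%N.
Proof.
case/card_gt0P => j _; apply/card_gt0P.
have a : 'I_(N j) := Ordinal (N_gt0 j).
have b0 : (0 < L %/ N j)%N by rewrite divn_gt0 // dvdn_leq.
by exists (Tagged (fun j => ('I_(N j) * 'I_(L %/ N j))%type) (a, Ordinal b0)).
Qed.

(** The source of all the averages below: a property that is read in the local
    model only has as frequency the mean of its local frequencies. *)
Lemma mu_count_amalgam (R : realType) (P : forall j, pred 'I_(N j)) :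
  mu_count R [pred i : 'I_amalgam_size |
                P (tag (decode i)) (tagged (decode i)).1]
  = #|J|%:R^-1 * \sum_j mu_count R (P j).
Proof.
have NE j : ((L %/ N j)%:R = L%:R / (N j)%:R :> R).
  rewrite -{2}(divnK (N_dvd j)) natrM mulfK // pnatr_eq0 -lt0n //.
have sizeE : (amalgam_size = #|J| * L)%N.
  transitivity (\sum_j #|'I_(N j)| * (L %/ N j))%N.
    by rewrite -(card_sigma_prod _ (fun j => xpredT)); apply: eq_card.
  rewrite (eq_bigr (fun=> L)) ?sum_nat_const // => j _.
  by rewrite card_ord mulnC divnK.
rewrite /mu_count (_ : #|_| = (\sum_j #|P j| * (L %/ N j))%N); last first.
  rewrite -card_sigma_prod -[RHS](fintype.card_image code_inj).
  apply: eq_card => i.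
  by rewrite -[i]decodeK (fintype.mem_image code_inj) !inE codeK.
rewrite sizeE natr_sum mulr_suml mulr_sumr; apply: eq_bigr => j _.
have [J0 Lu] : #|J|%:R != 0 :> R /\ L%:R != 0 :> R.
  by rewrite !pnatr_eq0 -!lt0n; split => //; apply/card_gt0P; exists j.
have Nu : (N j)%:R != 0 :> R by rewrite pnatr_eq0 -lt0n.
by rewrite !natrM NE; field; rewrite J0 Lu Nu.
Qed.

Lemma mu_count_fix_amalgam (R : realType) s :
  mu_count R [pred m | amalgam s m == Some m]
  = #|J|%:R^-1 * \sum_j mu_count R [pred m | s j m == Some m].
Proof.
rewrite -mu_count_amalgam; congr (_ / _); congr (_%:R); apply: eq_card => i.
rewrite !inE /= /amalgam_fun /= -[in X in _ == Some X](decodeK i).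
case: (decode i) => j [a b] /=; case: (s j a) => [c|] //=.
apply/eqP/eqP => [[/code_inj/eqP]|[->] //].
by rewrite eq_Tagged /= => /eqP [->].
Qed.

Lemma pbij_dist_amalgam (R : realType) s t :
  pbij_dist R (amalgam s) (amalgam t)
  = #|J|%:R^-1 * \sum_j pbij_dist R (s j) (t j).
Proof.
rewrite /pbij_dist big_split /= mulrDr -!mu_count_amalgam.
congr (_ / _ + _ / _); congr (_%:R); apply: eq_card => i.
  rewrite !inE /= /amalgam_fun /=.
  case: (decode i) => j [a b] /=.
  by case: (s j a) => [?|]; case: (t j a) => [?|].
rewrite !inE /= /amalgam_fun /=.
case: (decode i) => j [a b] /=.
case: (s j a) => [c|] //; case: (t j a) => [e|] //=.
congr (~~ _); apply/eqP/eqP => [[/code_inj/eqP]|[->] //].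
by rewrite eq_Tagged /= => /eqP [->].
Qed.

End amalgam.

(** * Null sets and classes of partial isomorphisms *)

Definition separating (d : measure_display) (T : measurableType d)
    (I : Type) (B : I -> set T) : Prop :=
  [/\ countable [set: I], (forall i, measurable (B i)) &
      forall x y, (forall i, B i x <-> B i y) -> x = y].

(** Balls of radius [1 / k] around the points of a countable dense set separate
    points; their interiors are taken to have open, hence Borel, sets.  The
    injection [e] of the dense set into the naturals indexes these sets without
    requiring the dense set to be nonempty. *)
Lemma standard_borel_separating (R : realType) (d : measure_display)
    (T : measurableType d) :
  standard_borel R T -> exists B : nat * nat -> set T, separating B.
Proof.
move=> [M [_ [D cD dD] [f bf fB]]].
have [e einj] := @countable_injP _ _ cD.
pose U (mk : nat * nat) : set M :=
  \bigcup_(q in [set q | D q /\ e q = mk.1]) (ball q mk.2.+1%:R^-1)^°.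
have oU mk : open (U mk) by apply: bigcup_open => q _; exact: open_interior.
exists (fun mk => f @^-1` (U mk)); split.
- exact: countableP.
- by move=> mk; apply/fB; exact: sub_sigma_algebra.
move=> x y xy; apply: (bij_inj bf); apply/eqP; apply: contrapT => /negP fxy.
have e0 : 0 < mdist (f x) (f y) / 2 by rewrite divr_gt0 // mdist_gt0.
pose k := Num.truncn (mdist (f x) (f y) / 2)^-1.
have ke : k.+1%:R^-1 < mdist (f x) (f y) / 2.
  by rewrite invf_plt ?posrE //; exact: truncnS_gt.
pose r : R := k.+1%:R^-1 / 2.
have r0 : 0 < r by rewrite divr_gt0.
have [q [qx Dq]] : ((ball (f x) r)^° `&` D) !=set0.
  apply: dD; last exact: open_interior.
  by exists (f x); exact: nbhsx_ballx.
have {}qx : ball (f x) r q by exact: interior_subset qx.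
have Ux : U (e q, k) (f x).
  exists q => //=; apply: filterS (nbhsx_ballx (f x) r r0) => z.
  rewrite [k.+1%:R^-1]splitr; apply: ball_triangle; exact: ball_sym.
have [q' [Dq' eq'] /interior_subset] := (xy (e q, k)).1 Ux.
have -> : q' = q by apply: einj; rewrite ?inE.
move=> /= qy; have : ball (f x) (r + k.+1%:R^-1) (f y).
  exact: ball_triangle qx qy.
rewrite ballEmdist /=; move: ke r0; rewrite /r.
set s := k.+1%:R^-1; set t := mdist _ _; lra.
Qed.

Section null_differences.
Context (d : measure_display) (T : measurableType d) (E : cber T).
Context (I : Type) (B : I -> set T) (sepB : separating B).
Implicit Types g h : pisom E.

Definition pdiff g h : set T := [set x | g x <> h x].

Definition pfix g : set T := [set x | g x = Some x].

Lemma pdomE g : pdom g = ppreimage g setT.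
Proof.
apply/seteqP; split=> x; rewrite /pdom /ppreimage /=.
  by case: (g x) => [y|] // _; exists y.
by case=> y _ ->.
Qed.

Lemma measurable_pdom g : measurable (pdom g).
Proof. by rewrite pdomE; apply: pisom_preimage. Qed.

(** Besides the points where only one of the maps is defined, these are the
    points where one of the countably many separating sets contains the value
    of one map but not that of the other. *)
Lemma measurable_pdiff g h : measurable (pdiff g h).
Proof.
have [cI mB sB] := sepB.
pose S g h := pdom g `\` pdom h `|`
  \bigcup_i (ppreimage g (B i) `\` ppreimage h (B i)).
have mS g' h' : measurable (S g' h').
  apply: measurableU; first by apply: measurableD; exact: measurable_pdom.
  apply: countable_bigcupT_measurable => // i.
  by apply: measurableD; apply: pisom_preimage.
rewrite (_ : pdiff g h = S g h `|` S h g); first exact: measurableU.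
apply/seteqP; split=> x; rewrite /pdiff /S /pdom /ppreimage /=.
  case gx: (g x) => [a|]; case hx: (h x) => [b|] // gh; last 2 first.
  - by left; left.
  - by right; left.
  have [i] : exists i, ~ (B i a <-> B i b).
    apply/existsNP => ab; apply: gh; congr Some; exact: sB.
  move=> /not_andP [] /not_implyP [Bi Bi']; [left|right]; right;
    exists i => //; split; first by exists a.
  - by case=> y By; rewrite hx => -[yE]; apply: Bi'; rewrite yE.
  - by exists b.
  - by case=> y By; rewrite gx => -[yE]; apply: Bi'; rewrite yE.
move=> [] [] => [[gx hx]|[i _ [[y By gx] nhx]]|
  [hx gx]|[i _ [[y By hx] ngx]]] E0.
- by apply: hx; rewrite -E0.
- by apply: nhx; exists y => //; rewrite -E0.
- by apply: gx; rewrite E0.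
- by apply: ngx; exists y => //; rewrite E0.
Qed.

Lemma measurable_pfix g : measurable (pfix g).
Proof.
rewrite (_ : pfix g = ~` pdiff g (pisom_id E)).
  exact/measurableC/measurable_pdiff.
apply/seteqP; split=> x /=; last by move/contrapT.
by move=> gx; apply.
Qed.

Section measure.
Context (R : realType) (mu : {measure set T -> \bar R}).

Lemma pisom_dist_eq0 g h : pisom_dist mu g h = 0%E <-> mu (pdiff g h) = 0%E.
Proof.
have mA : measurable (pdom g `+` pdom h).
  by apply: measurableU; apply: measurableD; exact: measurable_pdom.
pose S := [set x | [/\ pdom g x, pdom h x & g x <> h x]].
have SE : S = pdom g `&` pdom h `&` pdiff g h.
  by apply/seteqP; split=> x /=; [case|case=> [[]]].
have mS : measurable S.
  rewrite SE; apply: measurableI; last exact: measurable_pdiff.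
  by apply: measurableI; exact: measurable_pdom.
have DE : pdiff g h = (pdom g `+` pdom h) `|` S.
  apply/seteqP; split=> x; rewrite /S /pdiff /pdom /setY /=.
    case: (g x) => [a|]; case: (h x) => [b|] // gh; first by right.
    - by left; left.
    - by left; right.
  by case=> [[[]|[]]|[]] //; case: (g x); case: (h x).
rewrite /pisom_dist -/S; split=> [/eqP|D0].
  rewrite padde_eq0 // => /andP[/eqP A0 /eqP S0].
  by rewrite DE measureU0.
have mD := measurable_pdiff g h.
rewrite (subset_measure0 mA mD) // ?DE //.
by rewrite (subset_measure0 mS mD) ?adde0 // DE.
Qed.

Lemma pdiff_null_trans g h k :
  mu (pdiff g h) = 0%E -> mu (pdiff h k) = 0%E -> mu (pdiff g k) = 0%E.
Proof.
move=> gh hk.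
have mU : measurable (pdiff g h `|` pdiff h k).
  by apply: measurableU; exact: measurable_pdiff.
have U0 : mu (pdiff g h `|` pdiff h k) = 0%E.
  by rewrite measureU0 //; exact: measurable_pdiff.
apply: (subset_measure0 (measurable_pdiff g k) mU _ U0).
move=> x; rewrite /pdiff /= => gk.
have [gh'|] := pselect (g x = h x); last by left.
by right; rewrite -gh'.
Qed.

Lemma pdiffC g h : pdiff g h = pdiff h g.
Proof. by apply/seteqP; split=> x /nesym. Qed.

Lemma pclass_eqP g h : pclass mu g = pclass mu h <-> mu (pdiff g h) = 0%E.
Proof.
split=> [/(congr1 (fun C => sval C h)) /= gh|gh].
  apply/pisom_dist_eq0; rewrite gh; apply/pisom_dist_eq0.
  by rewrite (_ : pdiff h h = set0) ?measure0 //; apply/seteqP; split.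
have hg : mu (pdiff h g) = 0%E by rewrite pdiffC.
apply: eq_exist => /=; apply/seteqP; split=> k /= /pisom_dist_eq0 ?;
  apply/pisom_dist_eq0.
- exact: pdiff_null_trans hg _.
- exact: pdiff_null_trans gh _.
Qed.

Lemma pclass_surj (C : full_semigroup E mu) : exists g, pclass mu g = C.
Proof. by case: C => C [g gC]; exists g; exact: eq_exist. Qed.

(** Products differ where the inner maps do, or on the preimage under the inner
    map of the set where the outer maps do; invariance makes the latter null. *)
Lemma pclass_mul g g' h h' : invariant_measure E mu ->
  pclass mu g = pclass mu g' -> pclass mu h = pclass mu h' ->
  pclass mu (pisom_mul g h) = pclass mu (pisom_mul g' h').
Proof.
move=> inv /pclass_eqP gg' /pclass_eqP hh'; apply/pclass_eqP.
pose S := ppreimage h (pdiff g g').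
have mS : measurable S by apply: pisom_preimage; exact: measurable_pdiff.
have S0 : mu S = 0%E.
  rewrite -(inv h S) //; last by move=> x [y _ hx]; rewrite /pdom /= hx.
  apply: subset_measure0 gg'; [exact: pisom_image|exact: measurable_pdiff|].
  by move=> y [x [z Dz ->] [<-]].
have mU : measurable (pdiff h h' `|` S).
  by apply: measurableU => //; exact: measurable_pdiff.
have U0 : mu (pdiff h h' `|` S) = 0%E.
  by rewrite measureU0 //; exact: measurable_pdiff.
apply: (subset_measure0 (measurable_pdiff _ _) mU _ U0).
move=> x; rewrite /pdiff /S /ppreimage /= /Defs.pcomp => D.
have [hx|] := pselect (h x = h' x); last by left.
right; move: D; rewrite -hx; case: (h x) => [y|] //= gy.
by exists y.
Qed.

Lemma measure_pfix g h : pclass mu g = pclass mu h -> mu (pfix g) = mu (pfix h).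
Proof.
have le g' h' : mu (pdiff g' h') = 0%E -> (mu (pfix g') <= mu (pfix h'))%E.
  move=> gh; have mD := measurable_pdiff g' h'; have mF := measurable_pfix.
  rewrite -(measureU0 (mF h') mD gh); apply: le_measure; rewrite ?inE //.
  - exact: measurableU.
  - move=> x; rewrite /pfix /pdiff /= => gx.
    by have [<-|] := pselect (g' x = h' x); [left|right].
move=> /pclass_eqP gh; apply/eqP; rewrite eq_le !le //.
by rewrite pdiffC.
Qed.

End measure.
End null_differences.

(** * Disintegrations *)

Lemma min1_fine_measure (R : realType) (d : measure_display)
    (X : measurableType d) (m : {measure set X -> \bar R}) (A : set X) :
  m [set: X] = 1%E -> measurable A ->
  (Num.min 1 (fine (m A)))%:E = m A.
Proof.
move=> m1 mA; have A1 : (m A <= 1)%E.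
  by rewrite -m1; apply: le_measure; rewrite ?inE.
have Afin : m A \is a fin_num.
  by rewrite ge0_fin_numE //; apply: le_lt_trans A1 _; exact: ltry.
by rewrite min_r ?fineK // -lee_fin fineK.
Qed.

Section disintegration.
Context (R : realType) (d : measure_display) (X : measurableType d).
Context (mu nu : probability X R) (p : R.-ker X ~> X).
Hypothesis mup : disintegration mu nu p.

Lemma disintegration_null (A : set X) : measurable A -> mu A = 0%E ->
  {ae nu, forall x, p x A = 0%E}.
Proof.
move=> mA A0.
have mpA : measurable_fun setT (p ^~ A) by exact: measurable_kernel.
have := mup mA; rewrite A0 => /esym I0.
have : (\int[nu]_x `|p x A| = 0)%E.
  by rewrite -[RHS]I0; apply: eq_integral => x _; rewrite gee0_abs.
move/(ae_eq_integral_abs nu measurableT mpA).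
by apply: filterS => x; exact.
Qed.

(** The truncation by 1 makes the integrand bounded at every [x], although
    [p x] is a probability measure for almost every [x] only. *)
Lemma disintegration_truncated (A : set X) :
  {ae nu, forall x, p x [set: X] = 1%E} -> measurable A ->
  (\int[nu]_x (Num.min 1 (fine (p x A)))%:E = (fine (mu A))%:E)%E.
Proof.
move=> p1 mA; rewrite fineK ?fin_num_measure // mup //.
have minE : {ae nu, forall x, setT x -> (Num.min 1 (fine (p x A)))%:E = p x A}.
  by apply: filterS p1 => x px _; exact: min1_fine_measure.
apply: ge0_ae_eq_integral minE => //.
- apply/measurable_EFinP; apply: measurable_minr => //.
  apply: measurableT_comp; [exact: fine_measurable|exact: measurable_kernel].
- exact: measurable_kernel.
Qed.

End disintegration.

(** Sample points [y j] in a conull set are chosen such that the mean of the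
    [p (y j)]-measures of each relevant fixed point set is close to its
    [mu]-measure; the amalgam of sofic approximations of the [p (y j)] then
    approximates [mu].  Half of [eps] pays for the sampling, the other half
    for the local approximations. *)
Lemma sofic_disintegration (R : realType) (d : measure_display)
    (X : measurableType d) (stdX : standard_borel R X) (E : cber X)
    (mu nu : probability X R) (p : R.-ker X ~> X) :
  invariant_measure E mu -> disintegration mu nu p ->
  {ae nu, forall x, p x [set: X] = 1%E /\ sofic E (p x)} ->
  sofic E mu.
Proof.
move=> muE mup aep K eps finK eps0.
have [B sepB] := standard_borel_separating stdX.
pose S := full_semigroup E mu.
have rep_ex (c : S) := cid (pclass_surj c).
(* Maps on classes modulo [mu] are read modulo [p x] through [rep]. *)
pose rep (c : S) : pisom E := sval (rep_ex c).
have repK c : pclass mu (rep c) = c by exact: (svalP (rep_ex c)).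
have [s Ks] := (@finite_seqP {classic S} K).1 finK.
pose e i : S := tnth (in_tuple s) i.
have eP c : K c -> exists i, e i = c.
  by rewrite Ks /= => /(tnthP (in_tuple s))[i ->]; exists i.
pose A i := pfix (rep (e i)).
have mA i : measurable (A i) by exact: measurable_pfix sepB _.
pose same_class (g h : pisom E) x := pclass (p x) g = pclass (p x) h.
have ae_same_class g h : pclass mu g = pclass mu h ->
    {ae nu, forall x, same_class g h x}.
  move=> /(pclass_eqP sepB) gh.
  have := disintegration_null mup (measurable_pdiff sepB g h) gh.
  by apply: filterS => x /(pclass_eqP sepB).
pose prod i j := pisom_mul (rep (e i)) (rep (e j)).
(* The identities between representatives that must survive modulo [p x]. *)
pose G x := [/\ p x [set: X] = 1%E, sofic E (p x),
   same_class (rep (pclass mu (pisom_id E))) (pisom_id E) x,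
   same_class (rep (pclass mu (pisom_empty E))) (pisom_empty E) x &
   forall ij, same_class (rep (pclass mu (prod ij.1 ij.2))) (prod ij.1 ij.2) x].
have aeG : {ae nu, forall x, G x}.
  have h0 := ae_same_class _ _ (repK (pclass mu (pisom_id E))).
  have h1 := ae_same_class _ _ (repK (pclass mu (pisom_empty E))).
  have h2 : {ae nu, forall x, forall ij : 'I_(size s) * 'I_(size s),
      same_class (rep (pclass mu (prod ij.1 ij.2))) (prod ij.1 ij.2) x}.
    by apply: filter_forall => ij; apply: ae_same_class; exact: repK.
  by near=> x; split; near: x => //; apply: filterS aep => x [].
pose v i x : R := Num.min 1 (fine (p x (A i))).
have [||||J [y [J0 Gy avg]]] := @empirical_average R d X nu _ v
  (fun i => fine (mu (A i))) G (eps / 2) _ _ _ aeG _.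
- move=> i; apply: measurable_minr => //.
  apply: measurableT_comp; [exact: fine_measurable|exact: measurable_kernel].
- by move=> i x; rewrite le_min ler01 fine_ge0 //= ge_min lexx.
- move=> i; apply: disintegration_truncated => //.
  by apply: filterS aep => x [].
- by rewrite divr_gt0.
(* A sofic approximation at each sample point, for the images of [K]. *)
have loc j : exists Npi : {N : nat & full_semigroup E (p (y j)) -> pbij N},
  let: existT N pi := Npi in
  [/\ (0 < N)%N,
    pi (pclass _ (pisom_id E)) = pbij_id N,
    pi (pclass _ (pisom_empty E)) = pbij_empty N,
    (forall i k, pbij_dist R (pi (pclass _ (prod i k)))
       (pbij_mul (pi (pclass _ (rep (e i)))) (pi (pclass _ (rep (e k)))))
       < eps / 2) &
    (forall i, `|fine (p (y j) (A i)) -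
         mu_count R [pred m | pi (pclass _ (rep (e i))) m == Some m]|
       < eps / 2)].
  have [_ sof _ _ _] := Gy j.
  have [||N [pi [N0 pid pie pim pif]]] :=
    sof (range (fun i => pclass (p (y j)) (rep (e i)))) (eps / 2).
  - exact: finite_image.
  - by rewrite divr_gt0.
  exists (existT _ N pi); split => //.
  - by move=> i k; apply: pim; [exists i|exists k].
  - by move=> i; apply: pif; exists i.
pose Npi j := sval (cid (loc j)).
pose N j := projT1 (Npi j).
pose pi j : S -> pbij (N j) :=
  fun c => projT2 (Npi j) (pclass (p (y j)) (rep c)).
have piP j : [/\ (0 < N j)%N,
    pi j (pclass mu (pisom_id E)) = pbij_id (N j),
    pi j (pclass mu (pisom_empty E)) = pbij_empty (N j),
    (forall i k, pbij_dist R (pi j (pclass mu (prod i k)))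
       (pbij_mul (pi j (e i)) (pi j (e k))) < eps / 2) &
    (forall i, `|v i (y j) -
         mu_count R [pred m | pi j (e i) m == Some m]| < eps / 2)].
  rewrite /pi /N /Npi.
  case: (cid (loc j)) => [[Nj pij]] /= [N0 pid pie pim pif].
  have [py1 _ pyid pyempty pyprod] := Gy j.
  rewrite pyid pyempty; split => // [i k|i].
    by rewrite (pyprod (i, k)); exact: pim.
  by rewrite /v -[Num.min _ _]/(fine _%:E) min1_fine_measure //; exact: pif.
have N_gt0 j : (0 < N j)%N by case: (piP j).
pose Pi c := amalgam (fun j => pi j c).
have J_gt0 : 0 < #|J|%:R :> R by rewrite ltr0n.
have avg_lt (f : J -> R) (b : R) :
    (forall j, f j < b) -> #|J|%:R^-1 * \sum_j f j < b.
  move=> fb; rewrite mulrC ltr_pdivrMr //.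
  have [j0 _] := card_gt0P J0.
  rewrite mulr_natr -sumr_const; apply: ltr_sum => //.
  by apply/hasP; exists j0; rewrite ?mem_index_enum.
exists (amalgam_size N), Pi; split.
- exact: amalgam_size_gt0.
- apply: pbij_eq => i; rewrite -amalgam_id /Pi; congr (amalgam _ i).
  by apply/functional_extensionality_dep => j; case: (piP j).
- apply: pbij_eq => i; rewrite /Pi.
  rewrite (_ : (fun j => _) = fun j => pbij_empty (N j)) //.
  by apply/functional_extensionality_dep => j; case: (piP j).
- move=> g h Kg Kh; have [i ei] := eP _ Kg; have [k ek] := eP _ Kh.
  have -> : pclass mu (pisom_mul g h) = pclass mu (prod i k).
    by apply: (pclass_mul sepB muE); rewrite repK.
  rewrite -ei -ek /Pi -(pbij_eq (amalgam_mul _ _)) pbij_dist_amalgam //.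
  apply: lt_trans (_ : eps / 2 < eps); last by rewrite gtr_pMr ?invf_lt1 ?ltr1n.
  by apply: avg_lt => j; case: (piP j).
- move=> g Kg; have [i ei] := eP _ Kg.
  rewrite [fine _](_ : _ = fine (mu (A i))); last first.
    by congr fine; apply: (measure_pfix sepB); rewrite repK.
  rewrite -ei /Pi mu_count_fix_amalgam //.
  rewrite [eps]splitr.
  apply: le_lt_trans (ler_distD (#|J|%:R^-1 * \sum_j v i (y j)) _ _) _.
  apply: ltrD; first exact: avg.
  rewrite -mulrBr -sumrB normrM normfV (gtr0_norm J_gt0).
  apply: (@le_lt_trans _ _ (#|J|%:R^-1 * \sum_j `|v i (y j) -
      mu_count R [pred m | pi j (e i) m == Some m]|)).
    by apply: ler_wpM2l; [rewrite invr_ge0 ltW|exact: ler_norm_sum].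
  by apply: avg_lt => j; case: (piP j).
Unshelve. all: by end_near.
Qed.

Theorem theorem3p1 (R : realType) (d : measure_display) (X : measurableType d)
    (stdX : standard_borel R X) (E : cber X)
    (mu : probability X R) (muE : invariant_measure E mu) :
  (forall (nu : probability X R) (p : R.-ker X ~> X),
     disintegration mu nu p ->
     {ae nu, forall x, [/\ p x [set: X] = 1%E, invariant_measure E (p x)
                         & sofic E (p x)]} ->
     sofic E mu) /\
  (forall (nu : probability X R) (p : R.-ker X ~> X),
     ergodic_decomposition E mu nu p ->
     {ae nu, forall x, sofic E (p x)} ->
     sofic E mu).
Proof.
split=> nu p.
- move=> mup good; apply: sofic_disintegration mup _ => //.
  by apply: filterS good => x [].
- move=> [mup erg] sof; apply: sofic_disintegration mup _ => //.
  by apply: filterS2 erg sof => x [].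
Qed.
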